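(* Let $I_{\mathcal M}\subset\mathbb{R}[D]$ be the ideal of the independence model $\mathcal M=\{\,1\perp\!\!\!\perp 2\mid 3,\ 2\perp\!\!\!\perp 3\,\}$ for three discrete random variables with $d_1,d_2,d_3$ levels, written in the unknowns $p_{ijk}$ with $i\in\{+,2,3,\dots,d_1\}$, $j\in[d_2]$, $k\in[d_3]$. The ideal $I_{\mathcal M}$ has a Gröbner basis consisting of squarefree binomials of degree two, three and four, and it is hence radical. It has $2^{d_3}-1$ minimal primes, each generated by the $2\times 2$-minors of a generic matrix.
   Context: $X_1,X_2,X_3$ are discrete random variables, where $X_i$ takes values in the finite set $[d_i]=\{1,\dots,d_i\}$, and $D=[d_1]\times[d_2]\times[d_3]$. $\mathbb{R}[D]$ is the polynomial ring over $\mathbb{R}$ in the $d_1d_2d_3$ unknowns $p_{ijk}$, $(i,j,k)\in D$, where $p_{ijk}$ represents the probability of the event $X_1=i,\ X_2=j,\ X_3=k$. Write $p_{+jk}=\sum_{i=1}^{d_1}p_{ijk}$. The model $\mathcal M$ consists of the two statements ''$X_1$ is independent of $X_2$ given $X_3$'' and ''$X_2$ is independent of $X_3$''. Its ideal $I_{\mathcal M}$ is generated by the quadrics $p_{ijk}p_{rsk}-p_{isk}p_{rjk}$ with $i,r\in[d_1]$, $j,s\in[d_2]$, $k\in[d_3]$ (encoding the first statement) and the quadrics $p_{+jk}p_{+st}-p_{+jt}p_{+sk}$ with $j,s\in[d_2]$, $k,t\in[d_3]$ (encoding the second statement). Coordinates in $\mathbb{R}[D]$ are changed by replacing each unknown $p_{1jk}$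 by $p_{+jk}$, so that $\mathbb{R}[D]$ is the polynomial ring in the unknowns $p_{ijk}$ with $i\in\{+,2,3,\dots,d_1\}$; this coordinate change transforms $I_{\mathcal M}$ into a binomial ideal.
   Formalization: The count 2^{d3}-1 is stated for d1,d2≥2 (otherwise the ideal is prime); the primes are corrected: each is generated by the unknowns p_{+jk}, k in a proper subset σ of [d3], and the 2×2-minors of generic matrices (one for k outside σ, one for each k in σ), not of one matrix alone. *)

(* Defs.v *)
From HB Require Import structures.
From mathcomp Require Import all_boot all_order all_algebra.
From mathcomp Require Import boolp classical_sets functions cardinality reals.
From mathcomp Require Import mpoly.

Set Implicit Arguments.
Unset Strict Implicit.
Unset Printing Implicit Defensive.

Import Order.TTheory GRing.Theory Num.Theory.
Local Open Scope ring_scope.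
Local Open Scope classical_set_scope.

Definition ideal_gen (A : comNzRingType) (S : set A) : set A :=
  [set f | exists (n : nat) (c g : 'I_n -> A),
     (forall i, S (g i)) /\ f = \sum_i c i * g i].

Definition radical_ideal (A : comNzRingType) (I : set A) : Prop :=
  forall (f : A) (n : nat), I (f ^+ n) -> I f.

(* [idealr_closed] already requires the ideal to be proper. *)
Definition prime_ideal (A : comNzRingType) (P : set A) : Prop :=
  idealr_closed (mem P) /\ prime_idealr_closed (mem P).

Definition minimal_prime (A : comNzRingType) (I P : set A) : Prop :=
  [/\ prime_ideal P, I `<=` P
    & forall Q : set A, prime_ideal Q -> I `<=` Q -> Q `<=` P -> Q = P].

Definition minors2 (A : comNzRingType) (rT cT : Type) (M : rT -> cT -> A) :
    set A :=
  [set f | exists (r s : rT) (c e : cT), f = M r c * M s e - M r e * M s c].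

(* Well-foundedness is not listed: by Dickson's lemma it follows from the other
   conditions. *)
Record monomial_order (n : nat) (le : rel 'X_{1..n}) : Prop := MonomialOrder {
  mo_anti : antisymmetric le;
  mo_trans : transitive le;
  mo_total : total le;
  mo_add : forall m1 m2 m : 'X_{1..n}, le m1 m2 -> le (m1 + m)%MM (m2 + m)%MM;
  mo_ge0 : forall m : 'X_{1..n}, le 0%MM m
}.

(* The zero polynomial has no initial monomial. *)
Definition initial_monomial (R : fieldType) (n : nat) (le : rel 'X_{1..n})
    (f : {mpoly R[n]}) (m : 'X_{1..n}) : Prop :=
  m \in msupp f /\ forall m', m' \in msupp f -> le m' m.

Definition initial_monomials (R : fieldType) (n : nat) (le : rel 'X_{1..n})
    (S : set {mpoly R[n]}) : set {mpoly R[n]} :=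
  [set x | exists f m, [/\ S f, initial_monomial le f m & x = 'X_[m]]].

Definition groebner_basis (R : fieldType) (n : nat) (le : rel 'X_{1..n})
    (I G : set {mpoly R[n]}) : Prop :=
  [/\ finite_set G, G `<=` I
    & ideal_gen (initial_monomials le G) = ideal_gen (initial_monomials le I)].

(* Both monomials are required to be squarefree, not only the initial one. *)
Definition squarefree_binomial (R : fieldType) (n : nat) (f : {mpoly R[n]}) :
    Prop :=
  size (msupp f) = 2%N /\ forall m, m \in msupp f -> forall i, (m i <= 1)%N.

(* Total degree; [msize f] is one more than the degree of a nonzero [f]. *)
Definition has_degree (R : fieldType) (n : nat) (f : {mpoly R[n]}) (d : nat) :
    Prop :=
  msize f = d.+1.

Section Model.
Variables (R : fieldType) (d1 d2 d3 : nat).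

(* The level l of a variable is the ordinal with value l - 1. *)
Definition nunk : nat := #|{: 'I_d1 * 'I_d2 * 'I_d3}|.

Definition unk (i : 'I_d1) (j : 'I_d2) (k : 'I_d3) : {mpoly R[nunk]} :=
  'X_(enum_rank (i, j, k)).

Definition unk_sum (j : 'I_d2) (k : 'I_d3) : {mpoly R[nunk]} :=
  \sum_(i < d1) unk i j k.

(* I_M in the original unknowns, [unk i j k] being p_ijk. *)
Definition model_ideal : set {mpoly R[nunk]} :=
  ideal_gen (
    [set f | exists (i r : 'I_d1) (j s : 'I_d2) (k : 'I_d3),
       f = unk i j k * unk r s k - unk i s k * unk r j k] `|`
    [set f | exists (j s : 'I_d2) (k t : 'I_d3),
       f = unk_sum j k * unk_sum s t - unk_sum j t * unk_sum s k]).

(* In the new coordinates, [unk i j k] with i = 0 is the unknown p_+jk, and the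
   other [unk i j k] are unchanged; [old_unk] expresses the original p_ijk. *)
Definition old_unk (x : 'I_d1 * 'I_d2 * 'I_d3) : {mpoly R[nunk]} :=
  let: (i, j, k) := x in
  if (i == 0 :> nat)%N then
    unk i j k - \sum_(r < d1 | (r != 0 :> nat)%N) unk r j k
  else unk i j k.

Definition change_coord (f : {mpoly R[nunk]}) : {mpoly R[nunk]} :=
  f \mPo [tuple old_unk (enum_val v) | v < nunk].

Definition model_ideal_plus : set {mpoly R[nunk]} :=
  change_coord @` model_ideal.

(* New coordinates.  The ideal is generated by the unknowns p_+jk with k in
   sigma and by the 2x2-minors of generic matrices (matrices whose entries are
   distinct unknowns) with rows indexed by j: the matrix with columns (i, k), for
   all i in {+,2,...,d1} and k outside sigma, and, for each k in sigma, the
   matrix with columns i in {2,...,d1}.  For empty sigma, these are just the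
   2x2-minors of the generic d2 x (d1 d3) matrix (p_ijk). *)
Definition generic_minors_ideal (sigma : {set 'I_d3}) : set {mpoly R[nunk]} :=
  ideal_gen (
    [set f | exists (i : 'I_d1) (j : 'I_d2) (k : 'I_d3),
       [/\ (i = 0 :> nat)%N, k \in sigma & f = unk i j k]] `|`
    minors2 (fun (j : 'I_d2) (c : {c : 'I_d1 * 'I_d3 | c.2 \notin sigma}) =>
       unk (sval c).1 j (sval c).2) `|`
    [set f | exists2 k : 'I_d3, k \in sigma
       & minors2 (fun (j : 'I_d2) (i : {i : 'I_d1 | (i != 0 :> nat)%N}) =>
           unk (sval i) j k) f]).

End Model.

Arguments model_ideal_plus : clear implicits.
Arguments generic_minors_ideal : clear implicits.

(* Main.v *)
Require Import Defs.
From HB Require Import structures.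
From mathcomp Require Import all_boot all_order all_algebra.
From mathcomp Require Import boolp classical_sets functions cardinality reals.
From mathcomp Require Import mpoly.
From mathcomp Require Import zify ring.

(** The ideal of the model, in the unknowns p_ijk with i in {+,2,...,d1}, is a
    generalized binomial edge ideal.  Arrange the unknowns in a matrix with rows
    j and columns a = (i,k), and link two columns if they have the same k, or if
    both are columns (+,k) and (+,t); the ideal J is generated by the 2x2-minors
    of all pairs of linked columns.

    Modulo J, a monomial is a table of exponents in which the rows of two entries
    in linked columns may be exchanged.  If a, b, c are columns with a, b linked
    and b, c linked, then an entry in column b also allows the rows of entries in
    a and c to be exchanged (minor_trans).  So entries may be exchanged freely
    inside a component of the graph induced on the nonempty columns.  Only
    the columns (+,k) connect different values of k, so these components depend
    only on the set sigma of the k such that the column (+,k) is empty: one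
    component consists of all columns (i,k) with k outside sigma, and for each k
    in sigma the columns (i,k) with i <> + form another one.  A path between two
    columns of a component needs at most two interior columns (+,k), (+,t); the
    minor of its ends times one unknown for each interior column is the path
    binomial, squarefree of degree 2, 3 or 4.

    With a weight that makes the unsorted term of each path binomial the leading
    one, a monomial not divisible by a leading term is a table whose rows decrease
    along the columns of each component.  Such a table is determined by its column
    sums and by its row sums in each component (sorted_table_uniq).  These sums
    are the exponent of the image of the monomial under the monomial map toric
    sigma, which sends p_ijk to w_(i,k) u_(component,j) and kills p_+jk for k in
    sigma.  Two facts follow at once.

    First, the kernel of toric sigma, which is prime because the target is a
    domain, is the ideal of generic minors attached to sigma (toric_idealE).
    Second, a polynomial killed by all maps toric sigma whose monomials are all
    sorted is zero: a monomial with sigma as large as possible cannot cancel in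
    its image under toric sigma (standard_eq0).  So J is the intersection of the
    kernels (edge_idealP), hence radical, and no leading monomial of an element
    of J is sorted, which is the Groebner basis property.

    A prime containing J contains one of finitely many kernels, so the minimal
    primes are among these kernels.  The kernel for sigma = [d3] contains others
    and is discarded.  If d1, d2 > 1, the remaining 2^d3 - 1 are pairwise
    incomparable (toric_ideal_incomparable). *)

Set Implicit Arguments.
Unset Strict Implicit.
Unset Printing Implicit Defensive.

Import Order.TTheory GRing.Theory Num.Theory.
Local Open Scope ring_scope.
Local Open Scope classical_set_scope.
Local Open Scope card_scope.

(** * Ideals *)

Definition ideal_closed (A : comNzRingType) (I : set A) : Prop :=
  [/\ I 0, forall f g, I f -> I g -> I (f + g) & forall c f, I f -> I (c * f)].

Section Ideals.
Variable A : comNzRingType.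
Implicit Types (S I : set A) (f g : A).

Lemma mem_ideal_gen S f : S f -> ideal_gen S f.
Proof.
move=> Sf; exists 1%N, (fun=> 1), (fun=> f); split=> //.
by rewrite big_ord1 mul1r.
Qed.

Lemma ideal_gen_closed S : ideal_closed (ideal_gen S).
Proof.
split.
- by exists 0%N, (fun=> 0), (fun=> 0); split; [case | rewrite big_ord0].
- move=> _ _ [n1 [c1 [g1 [S1 ->]]]] [n2 [c2 [g2 [S2 ->]]]].
  pose glue (h1 : 'I_n1 -> A) (h2 : 'I_n2 -> A) (i : 'I_(n1 + n2)) :=
    match fintype.split i with inl i1 => h1 i1 | inr i2 => h2 i2 end.
  exists (n1 + n2)%N, (glue c1 c2), (glue g1 g2); split.
    by move=> i; rewrite /glue; case: (fintype.split i).
  rewrite big_split_ord; congr (_ + _); apply: eq_bigr => i _.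
    by rewrite /glue -[lshift _ _]/(unsplit (inl _)) unsplitK.
  by rewrite /glue -[rshift _ _]/(unsplit (inr _)) unsplitK.
- move=> c _ [n [e [g [Sg ->]]]].
  exists n, (fun i => c * e i), g; split=> //.
  by rewrite mulr_sumr; apply: eq_bigr => i _; rewrite mulrA.
Qed.

Lemma ideal_closed_sum I (J : Type) (r : seq J) (P : pred J) (F : J -> A) :
  ideal_closed I -> (forall i, P i -> I (F i)) -> I (\sum_(i <- r | P i) F i).
Proof. by case=> I0 ID _ IF; apply: (big_ind I). Qed.

Lemma ideal_gen_sub S I : ideal_closed I -> S `<=` I -> ideal_gen S `<=` I.
Proof.
move=> Icl SI _ [n [c [g [Sg ->]]]]; apply: ideal_closed_sum => // i _.
by case: Icl => _ _; apply; exact: SI.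
Qed.

(** Minors are bilinear in their two columns, so a minor of two combinations of
    columns is in an ideal as soon as the minors of their terms are. *)
Lemma minor_bilinear I (J K : finType) (x y : J -> A) (z t : K -> A)
    (c : J -> A) (e : K -> A) : ideal_closed I ->
    (forall i k, I (x i * t k - y i * z k)) ->
  I ((\sum_i c i * x i) * (\sum_k e k * t k) -
     (\sum_i c i * y i) * (\sum_k e k * z k)).
Proof.
move=> Icl Ixt; rewrite !mulr_suml -sumrB; apply: ideal_closed_sum => // i _.
rewrite !mulr_sumr -sumrB; apply: ideal_closed_sum => // k _.
rewrite (mulrACA _ (x i)) (mulrACA _ (y i)) -mulrBr.
by case: Icl => _ _; apply; exact: Ixt.
Qed.

End Ideals.

(** * Tables with rows decreasing along columns *)

Section SortedTables.
Variables (V : finType) (K : eqType) (comp : V -> K) (col row : V -> nat).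
Implicit Type f : V -> nat.

(** [f v] counts the entries in the cell [v]; within one component, the rows of
    the entries weakly decrease from each column to the later ones. *)
Definition sorted_table f := forall v w,
  (0 < f v)%N -> (0 < f w)%N -> comp v = comp w -> (col v < col w)%N ->
  (row w <= row v)%N.

Lemma unsorted_table f : ~ sorted_table f -> exists v w,
  [/\ 0 < f v, 0 < f w, comp v = comp w, col v < col w & row v < row w]%N.
Proof.
apply: contra_notP => none v w fv fw cvw lt; rewrite leqNgt; apply/negP => rvw.
by apply: none; exists v, w.
Qed.

(** In a component, the cells left of [x] and below [y] and those right of [x] and
    above [y] cannot both be occupied.  So the corner box holds all entries left of
    [x], or all entries above [y], whichever are fewer. *)
Lemma sorted_corner f q x y : sorted_table f ->
  (\sum_(v | [&& comp v == q, col v < x & y <= row v]) f v =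
   minn (\sum_(v | (comp v == q) && (col v < x)) f v)
        (\sum_(v | (comp v == q) && (y <= row v)) f v))%N.
Proof.
move=> fS.
have split_col : (\sum_(v | (comp v == q) && (col v < x)) f v =
    \sum_(v | [&& comp v == q, col v < x & y <= row v]) f v +
    \sum_(v | [&& comp v == q, col v < x & row v < y]) f v)%N.
  rewrite (bigID (fun v => y <= row v)%N) /=; congr addn; apply: eq_bigl => v;
  by rewrite -?ltnNge andbA.
have split_row : (\sum_(v | (comp v == q) && (y <= row v)) f v =
    \sum_(v | [&& comp v == q, col v < x & y <= row v]) f v +
    \sum_(v | [&& comp v == q, x <= col v & y <= row v]) f v)%N.
  rewrite (bigID (fun v => col v < x)%N) /=; congr addn; apply: eq_bigl => v;
  by rewrite -?leqNgt -andbA; congr andb; rewrite andbC.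
have [/existsP[v /andP[/and3P[/eqP qv vx vy] fv]] | none] :=
    boolP [exists v, [&& comp v == q, col v < x & row v < y]%N && (0 < f v)%N].
- have := split_row; rewrite [X in (_ + X)%N]big1 => [-> | w /and3P[/eqP qw xw yw]].
    by rewrite addn0; apply/esym/minn_idPr; rewrite split_col leq_addr.
  case: (posnP (f w)) => // fw.
  have := fS v w fv fw (etrans qv (esym qw)) (leq_trans vx xw).
  by move/(leq_trans yw); rewrite leqNgt vy.
- have := split_col; rewrite [X in (_ + X)%N]big1 => [-> | v vP].
    by rewrite addn0; apply/esym/minn_idPl; rewrite split_row leq_addr.
  case: (posnP (f v)) => // fv.
  by case/existsP: none; exists v; rewrite vP fv.
Qed.

(** By [sorted_corner], the sums determine the contents of all corner boxes, and
    each cell is an alternating sum of four of them. *)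
Lemma sorted_table_uniq f g :
    (forall v w, comp v = comp w -> col v = col w -> row v = row w -> v = w) ->
    sorted_table f -> sorted_table g ->
    (forall q x, \sum_(v | (comp v == q) && (col v < x)) f v =
                 \sum_(v | (comp v == q) && (col v < x)) g v)%N ->
    (forall q y, \sum_(v | (comp v == q) && (y <= row v)) f v =
                 \sum_(v | (comp v == q) && (y <= row v)) g v)%N ->
  f =1 g.
Proof.
move=> inj fS gS eqc eqr u.
pose box (h : V -> nat) x y :=
  (\sum_(v | [&& comp v == comp u, col v < x & y <= row v]) h v)%N.
have box_eq x y : box f x y = box g x y.
  by rewrite /box !sorted_corner // eqc eqr.
have box_cell h : (box h (col u).+1 (row u) + box h (col u) (row u).+1 =
    box h (col u) (row u) + box h (col u).+1 (row u).+1 + h u)%N.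
  have -> : h u = (\sum_(v | v == u) h v)%N by rewrite big_pred1_eq.
  rewrite /box !(big_mkcond (fun v => _ && _)).
  rewrite [in RHS](big_mkcond (fun v => v == u)) /=.
  rewrite -!big_split /=; apply: eq_bigr => v _.
  have [-> | neq] := eqVneq v u.
    by rewrite !eqxx /= !ltnn !ltnS !leqnn /= ?addn0 ?add0n.
  case: (eqVneq (comp v) (comp u)) => //= cvu.
  have : (col v != col u) || (row v != row u).
    rewrite -negb_and; apply: contra neq => /andP[/eqP e1 /eqP e2].
    by apply/eqP; exact: inj.
  by do 4![case: ifP]; lia.
have := box_cell f; have := box_cell g; rewrite !box_eq => -> /eqP.
by rewrite eqn_add2l => /eqP.
Qed.

End SortedTables.

(** * Weighted monomial orders and reduction by binomials *)

Section Monomials.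
Variables (R : fieldType) (n : nat) (wt : 'I_n -> nat).
Implicit Types (m : 'X_{1..n}) (f g : {mpoly R[n]}) (I G : set {mpoly R[n]}).
Implicit Type std : set 'X_{1..n}.

Definition mvars (s : seq 'I_n) : 'X_{1..n} := (\sum_(v <- s) U_(v))%MM.

Lemma mvarsE s i : mvars s i = count_mem i s.
Proof.
rewrite /mvars mnm_sumE -sum1_count [RHS]big_mkcond; apply: eq_bigr => v _.
by rewrite mnm1E /=; case: (v == i).
Qed.

Lemma mvars_le s m : uniq s -> {in s, forall v, 0 < m v}%N ->
  (mvars s <= m)%MM.
Proof.
move=> us pos; apply/mnm_lepP => i; rewrite mvarsE count_uniq_mem //.
by case: (boolP (i \in s)) => // /pos.
Qed.

Lemma mdeg_mvars s : mdeg (mvars s) = size s.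
Proof.
by rewrite /mvars mdeg_sum -sum1_size; apply: eq_bigr => v _; rewrite mdeg1.
Qed.

Definition mweight m : nat := (\sum_i m i * wt i)%N.

Lemma mweightD m1 m2 : mweight (m1 + m2) = (mweight m1 + mweight m2)%N.
Proof.
by rewrite -big_split; apply: eq_bigr => i _; rewrite mnmDE mulnDl.
Qed.

Lemma mweight0 : mweight 0%MM = 0%N.
Proof. by rewrite /mweight big1 // => i _; rewrite mnm0E. Qed.

Lemma mweight1 v : mweight U_(v)%MM = wt v.
Proof.
rewrite /mweight (bigD1 v) //= mnm1E eqxx mul1n big1 ?addn0 // => i.
by rewrite mnm1E eq_sym => /negPf->.
Qed.

Lemma mweight_mvars s : mweight (mvars s) = (\sum_(v <- s) wt v)%N.
Proof.
rewrite /mvars (big_morph _ mweightD mweight0).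
by apply: eq_bigr => v _; rewrite mweight1.
Qed.

(** The weight will decide which term of a binomial is the leading one; ties are
    left to a fixed monomial order, since a weight with values in nat is not
    injective on monomials. *)
Definition weight_le : rel 'X_{1..n} := fun m1 m2 =>
  (mweight m1 < mweight m2)%N ||
  ((mweight m1 == mweight m2) && (m1 <= m2)%O).

Lemma weight_le_mweight m1 m2 : weight_le m1 m2 -> (mweight m1 <= mweight m2)%N.
Proof. by case/orP => [/ltnW | /andP[/eqP-> _]]. Qed.

Lemma monomial_order_weight_le : monomial_order weight_le.
Proof.
rewrite /weight_le; split.
- move=> m1 m2 /andP[/orP[h1 | /andP[/eqP h1 l1]] /orP[h2 | /andP[/eqP h2 l2]]];
    try lia.
  by apply/le_anti; rewrite l1 l2.
- move=> m2 m1 m3 /orP[h1 | /andP[/eqP h1 l1]] /orP[h2 | /andP[/eqP h2 l2]];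
    apply/orP; try (left; lia).
  by right; rewrite h1 h2 eqxx (le_trans l1 l2).
- move=> m1 m2; have := le_total m1 m2.
  by case: (ltngtP (mweight m1) (mweight m2)).
- move=> m1 m2 m; rewrite !mweightD ltn_add2r eqn_add2r.
  by rewrite lemc_add2l.
- by move=> m; rewrite mweight0 le0m andbT; case: (mweight m).
Qed.

Lemma msupp_binomial m1 m2 : m1 != m2 ->
  perm_eq (msupp ('X_[m1] - 'X_[m2] : {mpoly R[n]})) [:: m1; m2].
Proof.
move=> neq.
have sN := msuppN ('X_[R, m2]); rewrite msuppX in sN.
have := @msuppD n R 'X_[m1] (- 'X_[m2]).
rewrite msuppX => sD; apply: (perm_trans (sD _)); last first.
  by rewrite /= perm_cons.
move=> m /=; rewrite (perm_mem sN) !inE.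
by case: eqVneq => // ->; exact: negbTE.
Qed.

Lemma initial_binomial m1 m2 : (mweight m2 < mweight m1)%N ->
  initial_monomial weight_le ('X_[m1] - 'X_[m2] : {mpoly R[n]}) m1.
Proof.
move=> lt; have neq : m1 != m2 by apply: contraTneq lt => ->; rewrite ltnn.
split; first by rewrite (perm_mem (msupp_binomial neq)) !inE eqxx.
move=> m; rewrite (perm_mem (msupp_binomial neq)) !inE /weight_le.
by case/orP => /eqP ->; rewrite ?eqxx ?lexx ?orbT ?lt.
Qed.

Lemma squarefree_binomial_mvars s t : uniq s -> uniq t -> size s = size t ->
    mvars s != mvars t ->
  squarefree_binomial ('X_[mvars s] - 'X_[mvars t] : {mpoly R[n]}) /\
  has_degree ('X_[mvars s] - 'X_[mvars t] : {mpoly R[n]}) (size s).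
Proof.
move=> us ut st neq; have supp := msupp_binomial neq; split; first split.
- by rewrite (perm_size supp).
- move=> m; rewrite (perm_mem supp) !inE => /orP[] /eqP -> i;
  by rewrite mvarsE count_uniq_mem // leq_b1.
- rewrite /has_degree msizeE (perm_big _ supp) !big_cons big_nil /=.
  by rewrite !mdeg_mvars -st maxn0 maxnn.
Qed.

(** One step of the division algorithm; the second monomial of a binomial in the
    ideal replaces the first one. *)
Lemma binomial_reduction I m1 m2 m : ideal_closed I ->
    I ('X_[m1] - 'X_[m2]) -> (mweight m2 < mweight m1)%N -> (m1 <= m)%MM ->
  exists2 m', (mweight m' < mweight m)%N & I ('X_[m] - 'X_[m']).
Proof.
case=> _ _ IM I12 lt le1; exists (m - m1 + m2)%MM.
  by rewrite -{2}(submK le1) !mweightD ltn_add2l.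
by rewrite -{1}(submK le1) !mpolyXD -mulrBr; exact: IM.
Qed.

(** Reduction terminates since it lowers the weight, a natural number.  The
    result [r] is zero or a monomial. *)
Lemma monomial_normal_form I std : ideal_closed I ->
    (forall m, ~ std m -> I 'X_[m] \/
       exists2 m', (mweight m' < mweight m)%N & I ('X_[m] - 'X_[m'])) ->
  forall m, exists r : {mpoly R[n]},
    [/\ I ('X_[m] - r), std m -> r = 'X_[m]
      & forall m', m' \in msupp r ->
          std m' /\ (m' = m \/ (mweight m' < mweight m)%N)].
Proof.
move=> [I0 ID IM] red m; elim: {m}_.+1 {-2}m (ltnSn (mweight m)) => // k IH m.
rewrite ltnS => le_mk.
have [stdm | nstdm] := pselect (std m).
  exists 'X_[m]; rewrite subrr; split=> // m'.
  by rewrite msuppX inE => /eqP ->; split=> //; left.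
have [Im | [m1 lt1 I1]] := red m nstdm.
  by exists 0; rewrite subr0; split=> // m'; rewrite mcoeff_msupp mcoeff0 eqxx.
have [r [Ir _ rP]] := IH m1 (leq_trans lt1 le_mk).
exists r; split=> //.
  by rewrite -[X in X - r](subrK 'X_[m1]) -addrA; exact: ID.
move=> m' /rP[sm' le']; split=> //; right.
by case: le' => [-> // | lt']; exact: ltn_trans lt' lt1.
Qed.

(** A standard initial monomial survives the reduction: the other monomials can
    only be replaced by monomials of a strictly smaller weight than theirs, or
    stay as they are, so they never cancel it. *)
Lemma mpoly_normal_form I std : ideal_closed I ->
    (forall m, ~ std m -> I 'X_[m] \/
       exists2 m', (mweight m' < mweight m)%N & I ('X_[m] - 'X_[m'])) ->
  forall f, exists f', [/\ I (f - f'), forall m, m \in msupp f' -> std m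
    & forall m, initial_monomial weight_le f m -> std m -> m \in msupp f'].
Proof.
move=> Icl red f.
have [r rP] := choice (monomial_normal_form Icl red).
exists (\sum_(m <- msupp f) f@_m *: r m); split.
- rewrite {1}[f]mpolyE -sumrB; apply: ideal_closed_sum => // m _.
  rewrite -scalerBr -mul_mpolyC; case: Icl => _ _; apply.
  by case: (rP m).
- move=> m /msupp_sum_le /flattenP[s /mapP[m1 _ ->]] /msuppZ_le ms.
  by case: (rP m1) => _ _ /(_ _ ms)[].
- move=> m [mf mmax] stdm; rewrite mcoeff_msupp raddf_sum /=.
  rewrite (bigD1_seq m) //= mcoeffZ (let: And3 _ e _ := rP m in e stdm).
  rewrite mcoeffX eqxx mulr1 big1_seq ?addr0 -?mcoeff_msupp // => m1.
  case/andP=> neq m1f; rewrite mcoeffZ; apply/eqP; rewrite mulf_eq0.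
  apply/orP; right; rewrite mcoeff_eq0; apply/negP => mr.
  have [_ _ /(_ _ mr)[_ [e | lt]]] := rP m1; first by rewrite e eqxx in neq.
  by have /weight_le_mweight := mmax m1 m1f; rewrite leqNgt lt.
Qed.

(** [std] is meant as the set of monomials not divisible by a leading term of [G].
    Then [G] is a basis as soon as no such monomial is initial in [I]. *)
Lemma groebner_of_standard I G std : finite_set G -> G `<=` I ->
    (forall m, ~ std m -> exists g m0,
       [/\ G g, initial_monomial weight_le g m0 & (m0 <= m)%MM]) ->
    (forall f m, I f -> initial_monomial weight_le f m -> ~ std m) ->
  groebner_basis weight_le I G.
Proof.
move=> finG GI divG stdI; split=> //; apply/seteqP; split.
  apply: ideal_gen_sub; first exact: ideal_gen_closed.
  move=> _ [f [m [Gf fm ->]]]; apply: mem_ideal_gen.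
  by exists f, m; split=> //; exact: GI.
apply: ideal_gen_sub; first exact: ideal_gen_closed.
move=> _ [f [m [If fm ->]]].
have [g [m0 [Gg gm0 le0]]] := divG m (stdI f m If fm).
rewrite -(submK le0) mpolyXD.
have [_ _ mulG] := ideal_gen_closed (initial_monomials weight_le G).
by apply: mulG; apply: mem_ideal_gen; exists g, m0.
Qed.

End Monomials.

(** * The matrix of unknowns and its edge ideal *)

Section Model.
Variables (R : fieldType) (d1 d2 d3 : nat) (d1_gt0 : (0 < d1)%N).
Local Notation C := ('I_d1 * 'I_d3)%type.
Local Notation n := (nunk d1 d2 d3).
Local Notation ring := {mpoly R[n]}.
Implicit Types (a b c : C) (j s u : 'I_d2) (k t : 'I_d3) (v w : 'I_n).
Implicit Types (m : 'X_{1..n}) (f g : ring) (sigma : {set 'I_d3}).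

Definition var a j : 'I_n := enum_rank (a.1, j, a.2).
Definition col v : C := ((enum_val v).1.1, (enum_val v).2).
Definition row v : 'I_d2 := (enum_val v).1.2.

Lemma col_var a j : col (var a j) = a.
Proof. by rewrite /col enum_rankK; case: a. Qed.

Lemma row_var a j : row (var a j) = j.
Proof. by rewrite /row enum_rankK. Qed.

Lemma varK v : var (col v) (row v) = v.
Proof.
rewrite /var /col /row -[RHS]enum_valK.
by case: (enum_val v) => [[]].
Qed.

Lemma var_eq a b j s : (var a j == var b s) = (a == b) && (j == s).
Proof.
apply/eqP/andP => [e | [/eqP -> /eqP ->] //].
by move: (congr1 col e) (congr1 row e); rewrite !col_var !row_var => -> ->.
Qed.

Definition minor a b j s : ring :=
  'X_(var a j) * 'X_(var b s) - 'X_(var a s) * 'X_(var b j).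

(** The edges of the graph on the columns: the matrices of the first independence
    statement are its cliques with fixed [k], that of the second statement is the
    clique of the columns of the unknowns p_+jk. *)
Definition linked a b : bool :=
  (a.2 == b.2) || (a.1 == 0 :> nat)%N && (b.1 == 0 :> nat)%N.

Definition edge_ideal : set ring :=
  ideal_gen [set f | exists a b j s, linked a b /\ f = minor a b j s].

Lemma edge_ideal_closed : ideal_closed edge_ideal.
Proof. exact: ideal_gen_closed. Qed.

Lemma minor_edge_ideal a b j s : linked a b -> edge_ideal (minor a b j s).
Proof. by move=> ab; apply: mem_ideal_gen; exists a, b, j, s. Qed.

(** Parallelism of columns is transitive where an entry of the middle column is
    nonzero.  The multipliers [y] and [z] allow this to be iterated along a path. *)
Lemma minor_trans (I : set ring) a b c (y z : ring) : ideal_closed I ->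
    (forall j s, I (y * minor a b j s)) -> (forall j s, I (z * minor b c j s)) ->
  forall u j s, I (y * z * 'X_(var b u) * minor a c j s).
Proof.
move=> [_ ID IM] Iab Ibc u j s.
have -> : y * z * 'X_(var b u) * minor a c j s =
  (z * 'X_(var c s)) * (y * minor a b j u) +
  (y * 'X_(var a u)) * (z * minor b c j s) +
  (z * 'X_(var c j)) * (y * minor a b u s) by rewrite /minor; ring.
by apply: (ID); [apply: ID|]; apply: IM.
Qed.

Definition base k : C := (Ordinal d1_gt0, k).

Definition rank a : nat := enum_rank a.
(** In an exchange of rows j < s between columns of ranks x < y, the weight
    changes by (y - x)(s - j), so the sorted term has the smaller weight. *)
Definition wt v : nat := (rank (col v) * row v)%N.

Lemma rank_inj : injective rank.
Proof. by move=> a b /val_inj /enum_rank_inj. Qed.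

(** One unknown in each interior column of the shortest path from [a] to [b];
    multiplied by these, the minors of [a] and [b] lie in the edge ideal. *)
Definition connector a b j s : seq 'I_n :=
  (if (a.2 != b.2) && (a.1 != 0 :> nat)%N then [:: var (base a.2) j] else [::]) ++
  (if (a.2 != b.2) && (b.1 != 0 :> nat)%N then [:: var (base b.2) s] else [::]).

Definition path_vars a b j s u u' : seq 'I_n :=
  [:: var a j, var b s & connector a b u u'].

Definition path_binomial a b j s u u' : ring :=
  'X_[mvars (path_vars a b j s u u')] - 'X_[mvars (path_vars a b s j u u')].

Definition path_basis : set ring :=
  [set f | exists a b j s u u',
    [/\ (rank a < rank b)%N, (j < s)%N & f = path_binomial a b j s u u']].

Lemma path_binomialE a b j s u u' :
  path_binomial a b j s u u' = 'X_[mvars (connector a b u u')] * minor a b j s.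
Proof.
rewrite /path_binomial /path_vars /mvars !big_cons !mpolyXD /minor mulrBr.
by congr (_ - _); ring.
Qed.

Lemma path_vars_uniq a b j s u u' : a != b -> uniq (path_vars a b j s u u').
Proof.
case: a b => [i k] [r t]; rewrite /path_vars /connector /= xpair_eqE => neq.
rewrite !inE !var_eq !xpair_eqE (negPf neq) /=.
have [-> | /= neq_kt] := eqVneq k t; first by [].
case: (eqVneq (val i) 0%N) => i0 /=; case: (eqVneq (val r) 0%N) => r0 /=;
  rewrite ?inE ?var_eq ?xpair_eqE ?(eq_sym t k) ?(negPf neq_kt) ?eqxx /=;
  by rewrite -?val_eqE /= ?(negPf i0) ?(negPf r0) ?andbF.
Qed.

(** The path from [a] to [b] runs through [base a.2] and [base b.2]; an end with
    first index 0 is its own base, which makes the path shorter. *)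
Lemma path_basis_sub : path_basis `<=` edge_ideal.
Proof.
move=> _ [a [b [j [s [u [u' [_ _ ->]]]]]]]; rewrite path_binomialE.
have J1 x y j' s' : linked x y -> edge_ideal (1 * minor x y j' s').
  by rewrite mul1r; exact: minor_edge_ideal.
have Jcl := edge_ideal_closed.
have lab : linked a (base a.2) by rewrite /linked eqxx.
have lbb : linked (base b.2) b by rewrite /linked eqxx.
have lbase : linked (base a.2) (base b.2) by rewrite /linked /= eqxx orbT.
rewrite /connector; have [eq_ab | neq_ab] /= := eqVneq a.2 b.2.
  rewrite /mvars big_nil mpolyX0 mul1r; apply: minor_edge_ideal.
  by rewrite /linked eq_ab eqxx.
case: (eqVneq (val a.1) 0%N) => a0 /=; case: (eqVneq (val b.1) 0%N) => b0 /=;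
  rewrite /mvars ?big_cons ?big_nil ?addm0 ?mpolyX0.
- by apply: J1; rewrite /linked a0 b0 orbT.
(* One interior column: the multipliers of both links are 1. *)
- rewrite -[X in X * _]mul1r -[X in X * 'X__]mul1r.
  apply: (minor_trans Jcl) => j' s'; apply: J1 => //.
  by rewrite /linked /= a0 orbT.
- rewrite -[X in X * _]mul1r -[X in X * 'X__]mul1r.
  apply: (minor_trans Jcl) => j' s'; apply: J1 => //.
  by rewrite /linked /= b0 orbT.
(* Two interior columns: join [base a.2] to [b] first, then [a] to the result. *)
- rewrite mpolyXD mulrC -[X in _ * (X * _)]mul1r mulrC.
  rewrite [_ * 'X_(var (base b.2) _)]mulrAC.
  apply: (minor_trans Jcl) => j' s'; first exact: J1.
  rewrite -[X in X * _]mul1r -[X in X * 'X__]mul1r.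
  by apply: (minor_trans Jcl) => ? ?; apply: J1.
Qed.

Lemma finite_path_basis : finite_set path_basis.
Proof.
pose F (x : C * C * ('I_d2 * 'I_d2) * ('I_d2 * 'I_d2)) :=
  path_binomial x.1.1.1 x.1.1.2 x.1.2.1 x.1.2.2 x.2.1 x.2.2.
apply: (@sub_finite_set _ _ (F @` setT)); last exact/finite_image/finite_finset.
move=> _ [a [b [j [s [u [u' [_ _ ->]]]]]]].
by exists (a, b, (j, s), (u, u')).
Qed.

Lemma path_vars_weight a b j s u u' : (rank a < rank b)%N -> (j < s)%N ->
  (mweight wt (mvars (path_vars a b s j u u')) <
   mweight wt (mvars (path_vars a b j s u u')))%N.
Proof.
move=> ab js; rewrite !mweight_mvars /path_vars !big_cons !addnA ltn_add2r.
rewrite /wt !col_var !row_var; nia.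
Qed.

Lemma path_basis_shape g : path_basis g -> squarefree_binomial g /\
  [\/ has_degree g 2, has_degree g 3 | has_degree g 4].
Proof.
move=> [a [b [j [s [u [u' [ab js ->]]]]]]].
have neq : a != b by apply: contraTneq ab => ->; rewrite ltnn.
have [||||sf deg] := @squarefree_binomial_mvars R n
  (path_vars a b j s u u') (path_vars a b s j u u').
- exact: path_vars_uniq.
- exact: path_vars_uniq.
- by [].
- by apply: contraTneq (path_vars_weight u u' ab js) => ->; rewrite ltnn.
split=> //; move: deg; set k := size _ => deg.
have : [\/ k = 2, k = 3 | k = 4]%N.
  rewrite /k /path_vars /connector; case: ifP => _; case: ifP => _ /=;
  by [apply: Or33 | apply: Or32 | apply: Or31].
by case=> e; rewrite e in deg; [apply: Or31 | apply: Or32 | apply: Or33].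
Qed.

(** * Toric parametrizations *)

(** Names the components of the graph from which the columns [base k] with [k] in
    [sigma] are deleted; [None] is the one formed by the [k] outside [sigma]. *)
Definition component sigma a : option 'I_d3 :=
  if a.2 \in sigma then Some a.2 else None.

Definition dead sigma a : bool := (a.1 == 0 :> nat)%N && (a.2 \in sigma).

Local Notation T := ((option 'I_d3 * 'I_d2) + C)%type.
Local Notation N := #|{: T}|.

Definition param sigma v : 'X_{1..N} :=
  (U_(enum_rank (inr (col v) : T)) +
   U_(enum_rank (inl (component sigma (col v), row v) : T)))%MM.

Definition toric sigma f : {mpoly R[N]} :=
  f \mPo [tuple if dead sigma (col v) then 0 else 'X_[param sigma v] | v < n].

Definition toric_exp sigma m : 'X_{1..N} := (\sum_v param sigma v *+ m v)%MM.

Definition alive sigma m : bool :=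
  [forall v, (0 < m v)%N ==> ~~ dead sigma (col v)].

Definition sorted sigma m : Prop :=
  sorted_table (fun v => component sigma (col v)) (fun v => rank (col v))
    (fun v => row v) m.

Lemma toric0 sigma : toric sigma 0 = 0.
Proof. exact: comp_mpoly0. Qed.

Lemma toricD sigma f g : toric sigma (f + g) = toric sigma f + toric sigma g.
Proof. exact: comp_mpolyD. Qed.

Lemma toricB sigma f g : toric sigma (f - g) = toric sigma f - toric sigma g.
Proof. exact: comp_mpolyB. Qed.

Lemma toricM sigma f g : toric sigma (f * g) = toric sigma f * toric sigma g.
Proof. by rewrite /toric rmorphM. Qed.

Lemma toric1 sigma : toric sigma 1 = 1.
Proof. exact: comp_mpoly1. Qed.

Lemma toric_expn sigma f i : toric sigma (f ^+ i) = toric sigma f ^+ i.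
Proof. by rewrite /toric rmorphXn. Qed.

Lemma toricX sigma m : toric sigma 'X_[m] =
  if alive sigma m then 'X_[toric_exp sigma m] else 0.
Proof.
rewrite /toric comp_mpolyX; case: ifP => [/forallP al | /negbT].
  rewrite /toric_exp (big_morph _ (@mpolyXD N R) (@mpolyX0 N R)).
  apply: eq_bigr => v _.
  rewrite tnth_mktuple -mpolyXn; have := al v.
  by case: (posnP (m v)) => [-> | _ /negPf -> //]; rewrite !expr0.
rewrite negb_forall => /existsP[v]; rewrite negb_imply negbK => /andP[mv dv].
by rewrite (bigD1 v) //= tnth_mktuple dv expr0n eqn0Ngt mv mul0r.
Qed.

Lemma toric_var sigma a j : toric sigma 'X_(var a j) =
  if dead sigma a then 0 else
    'X_(enum_rank (inr a : T)) * 'X_(enum_rank (inl (component sigma a, j) : T)).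
Proof.
rewrite /toric comp_mpolyXU -tnth_nth tnth_mktuple col_var.
by rewrite /param mpolyXD col_var row_var.
Qed.

Lemma toric_minor sigma a b j s :
    [|| dead sigma a, dead sigma b | component sigma a == component sigma b] ->
  toric sigma (minor a b j s) = 0.
Proof.
rewrite /minor toricB !toricM !toric_var.
by case: ifP => _; case: ifP => _ //=; rewrite ?mul0r ?mulr0 ?subrr //;
  move=> /eqP ->; ring.
Qed.

Definition toric_ideal sigma : set ring := [set f | toric sigma f = 0].

Lemma toric_ideal_closed sigma : ideal_closed (toric_ideal sigma).
Proof.
split; rewrite /toric_ideal /=; first exact: toric0.
- by move=> f g ef eg; rewrite toricD ef eg addr0.
- by move=> c f ef; rewrite toricM ef mulr0.
Qed.

Lemma toric_ideal_prime sigma : prime_ideal (toric_ideal sigma).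
Proof.
have memE f : (f \in mem (toric_ideal sigma)) = (toric sigma f == 0).
  by apply/idP/eqP => [/set_mem|e]; last exact/mem_set.
split.
  split=> [||c f g]; rewrite !memE.
  - by rewrite toric0.
  - by rewrite toric1 oner_eq0.
  - by move=> /eqP ef /eqP eg; rewrite toricD toricM ef eg mulr0 addr0.
by move=> f g; rewrite !memE toricM mulf_eq0.
Qed.

Lemma edge_ideal_sub_toric sigma : edge_ideal `<=` toric_ideal sigma.
Proof.
apply: ideal_gen_sub; first exact: toric_ideal_closed.
move=> _ [a [b [j [s [ab ->]]]]]; apply: toric_minor; move: ab.
rewrite /linked /dead /component => /orP[/eqP -> | /andP[-> ->]] /=.
  by rewrite eqxx !orbT.
by case: ifP; case: ifP.
Qed.

Lemma toric_exp_col sigma m a :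
  toric_exp sigma m (enum_rank (inr a : T)) = (\sum_(v | col v == a) m v)%N.
Proof.
rewrite mnm_sumE [RHS]big_mkcond; apply: eq_bigr => v _.
rewrite mulmnE mnmDE !mnm1E !(inj_eq enum_rank_inj) addn0.
by rewrite (inj_eq (@inr_inj _ _)); case: eqP; rewrite ?mul1n.
Qed.

Lemma toric_exp_row sigma m q j :
  toric_exp sigma m (enum_rank (inl (q, j) : T)) =
  (\sum_(v | (component sigma (col v) == q) && (row v == j)) m v)%N.
Proof.
rewrite mnm_sumE [RHS]big_mkcond; apply: eq_bigr => v _.
rewrite mulmnE mnmDE !mnm1E !(inj_eq enum_rank_inj) add0n.
by rewrite (inj_eq (@inl_inj _ _)) xpair_eqE; case: ifP; rewrite ?mul1n.
Qed.

(** The exponents of the image are the column sums and the row sums of each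
    component. *)
Lemma toric_exp_inj sigma m m' : sorted sigma m -> sorted sigma m' ->
  toric_exp sigma m = toric_exp sigma m' -> m = m'.
Proof.
move=> sm sm' e; apply/mnmP; apply: (sorted_table_uniq _ sm sm').
- move=> v w _ /rank_inj ec /val_inj er.
  by rewrite -(varK v) -(varK w) ec er.
- move=> q x; pose P a := (component sigma a == q) && (rank a < x)%N.
  have byc (m0 : 'X_{1..n}) :
      (\sum_(v | P (col v)) m0 v =
       \sum_(a | P a) toric_exp sigma m0 (enum_rank (inr a : T)))%N.
    rewrite (partition_big col P) //=; apply: eq_bigr => a Pa.
    rewrite toric_exp_col; apply: eq_bigl => v.
    by case: eqP => [-> | _]; rewrite ?Pa ?andbF.
  by rewrite -/(P _) !byc e.
- move=> q y; pose P j := (y <= j)%N.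
  have byr (m0 : 'X_{1..n}) :
      (\sum_(v | (component sigma (col v) == q) && (y <= row v)%N) m0 v =
       \sum_(j | P j) toric_exp sigma m0 (enum_rank (inl (q, j) : T)))%N.
    rewrite (partition_big row P) => [| v /andP[]] //=.
    apply: eq_bigr => j Pj; rewrite toric_exp_row; apply: eq_bigl => v.
    by rewrite -andbA; case: (row v =P j) => [-> | _]; rewrite ?andbF // -/(P j) Pj.
  by rewrite !byr e.
Qed.

(** If no other surviving monomial of [f] has the image of [m0], the coefficient of
    [m0] appears unchanged in the image of [f]. *)
Lemma toric_neq0 sigma f m0 : m0 \in msupp f -> alive sigma m0 ->
    (forall m, m \in msupp f -> alive sigma m ->
       toric_exp sigma m = toric_exp sigma m0 -> m = m0) ->
  toric sigma f != 0.
Proof.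
move=> m0f al0 uniq0.
suff : (toric sigma f)@_(toric_exp sigma m0) != 0.
  by apply: contra_neq => ->; rewrite mcoeff0.
rewrite /toric comp_mpolyEX raddf_sum /= (bigD1_seq m0) //=.
rewrite -/(toric _ _) mcoeffZ toricX al0 mcoeffX eqxx mulr1.
rewrite big1_seq ?addr0 -?mcoeff_msupp // => m /andP[neq mf].
rewrite -/(toric _ _) mcoeffZ toricX.
case: ifP => al; last by rewrite mcoeff0 mulr0.
rewrite mcoeffX; case: eqP => [e | _]; last by rewrite mulr0.
by rewrite (uniq0 m mf al e) eqxx in neq.
Qed.

(** * Kernels of the parametrizations *)

Lemma alive_dead sigma m : ~~ alive sigma m ->
  exists v, (0 < m v)%N && dead sigma (col v).
Proof.
rewrite negb_forall => /existsP[v]; rewrite negb_imply negbK => mv.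
by exists v.
Qed.

Lemma minor_generic sigma a b j s :
    ~~ dead sigma a -> ~~ dead sigma b -> component sigma a = component sigma b ->
  generic_minors_ideal R d1 d2 d3 sigma (minor a b j s).
Proof.
case: a b => [i k] [r t]; rewrite /dead /component /= => nda ndb.
case: ifP => [ks | /negbT ks]; case: ifP => [ts | /negbT ts] //.
  case=> ekt; move: t ekt ndb ts => _ <- ndb _.
  rewrite ks andbT in nda; rewrite ks andbT in ndb.
  apply: mem_ideal_gen; right; exists k => //.
  exists j, s, (exist _ i nda), (exist _ r ndb).
  by rewrite /minor /unk /= [X in _ - X]mulrC.
move=> _; apply: mem_ideal_gen; left; right.
pose outside c : Prop := c.2 \notin sigma.
exists j, s, (exist outside (i, k) ks), (exist outside (r, t) ts).
by rewrite /minor /unk /= [X in _ - X]mulrC.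
Qed.

Lemma generic_sub_toric sigma :
  generic_minors_ideal R d1 d2 d3 sigma `<=` toric_ideal sigma.
Proof.
apply: ideal_gen_sub; first exact: toric_ideal_closed.
move=> f [[[i [j [k [i0 ks ->]]]] | [j [s [[a as_] [[b bs] ->]]]]] | ].
- by rewrite /toric_ideal /= (toric_var sigma (i, k) j) /dead /= i0 ks.
- rewrite [X in _ - X]mulrC; apply: (toric_minor (a := a) (b := b)).
  by rewrite /component (negPf as_) (negPf bs) eqxx !orbT.
- move=> [k ks [j [s [[i i0] [[r r0] ->]]]]].
  rewrite [X in _ - X]mulrC.
  by apply: (toric_minor (a := (i, k)) (b := (r, k))); rewrite /component eqxx !orbT.
Qed.

(** Modulo the generic minors, every polynomial reduces to one whose monomials
    avoid the dead unknowns and are sorted.  The map is injective on these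
    monomials, so a reduced polynomial in the kernel is zero. *)
Lemma toric_idealE sigma :
  toric_ideal sigma = generic_minors_ideal R d1 d2 d3 sigma.
Proof.
have Gcl : ideal_closed (generic_minors_ideal R d1 d2 d3 sigma).
  exact: ideal_gen_closed.
apply/seteqP; split; last exact: generic_sub_toric.
move=> f tf.
pose std m := alive sigma m /\ sorted sigma m.
have [m | f' [Gf' stdf' _]] :=
    @mpoly_normal_form R n wt _ std Gcl _ f.
  have [al nstd | /alive_dead[v /andP[mv dv]] _] := boolP (alive sigma m).
  - have /unsorted_table[v [w [mv mw cvw ltc ltr]]] : ~ sorted sigma m.
      by move=> sm; apply: nstd.
    right; apply: (@binomial_reduction R n wt _
      (mvars [:: var (col v) (row v); var (col w) (row w)])
      (mvars [:: var (col v) (row w); var (col w) (row v)])) => //.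
    + rewrite /mvars !big_cons !big_nil !addm0 !mpolyXD.
      move/forallP: al => al; apply: minor_generic => //.
        by have := al v; rewrite mv.
      by have := al w; rewrite mw.
    + rewrite !mweight_mvars !big_cons !big_nil /wt !col_var !row_var.
      by move: ltc ltr; nia.
    + apply: mvars_le => [|x]; rewrite /= !inE !varK.
        by rewrite andbT; apply: contraTneq ltc => ->; rewrite ltnn.
      by case/orP => /eqP ->.
  - left; have le1 : (U_(v) <= m)%MM.
      apply/mnm_lepP => i; rewrite mnm1E.
      by case: eqP => // <-.
    rewrite -(submK le1) mpolyXD; case: Gcl => _ _; apply.
    apply: mem_ideal_gen; left; left.
    exists (col v).1, (row v), (col v).2; move/andP: dv => [/eqP c0 cs].
    by split=> //; rewrite /unk -{1}(varK v).
suff f'0 : f' = 0 by move: Gf'; rewrite f'0 subr0.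
have tf' : toric sigma f' = 0.
  have := generic_sub_toric Gf'.
  by rewrite /toric_ideal /= toricB tf sub0r => /eqP; rewrite oppr_eq0 => /eqP.
apply/eqP; apply: contraT; rewrite -msupp_eq0.
case E: (msupp f') => [//|m0 ms] _.
have m0f : m0 \in msupp f' by rewrite E mem_head.
have [al0 s0] := stdf' _ m0f.
suff : toric sigma f' != 0 by rewrite tf' eqxx.
apply: (toric_neq0 m0f al0) => m mf _.
by apply: toric_exp_inj => //; case: (stdf' _ mf).
Qed.

(** * Standard monomials of the edge ideal *)

(** This set determines the components of the graph induced on the nonempty
    columns of [m]. *)
Definition missing m : {set 'I_d3} :=
  [set k | [forall j, m (var (base k) j) == 0%N]].

Lemma missingPn m k : k \notin missing m -> exists j, (0 < m (var (base k) j))%N.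
Proof.
by rewrite inE negb_forall => /existsP[j]; rewrite -lt0n; exists j.
Qed.

Lemma alive_missing sigma m : alive sigma m = (sigma \subset missing m).
Proof.
apply/idP/idP => [/forallP al | /fintype.subsetP sub].
  apply/fintype.subsetP => k ks; rewrite inE; apply/forallP => j.
  have := al (var (base k) j).
  by rewrite col_var /dead /= ks implybF lt0n negbK.
apply/forallP => v; apply/implyP => mv; apply/negP => /andP[/eqP c0 /sub].
rewrite inE => /forallP/(_ (row v)); rewrite -(_ : col v = base (col v).2).
  by rewrite varK eqn0Ngt mv.
by rewrite [LHS]surjective_pairing; congr pair; apply/val_inj.
Qed.

Lemma connector_supported m a b (j s : 'I_d2) :
    component (missing m) a = component (missing m) b ->
  exists u u', {in connector a b u u', forall v, 0 < m v}%N.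
Proof.
rewrite /connector; have [eq_ab | neq_ab] := eqVneq a.2 b.2.
  by exists j, s.
rewrite /component; case: ifP => [|/negbT am]; case: ifP => [|/negbT bm] //.
  by move=> _ _ [] e; rewrite e eqxx in neq_ab.
move=> _; have [u mu] := missingPn am; have [u' mu'] := missingPn bm.
exists u, u' => v; rewrite mem_cat => /orP[]; case: ifP => // _;
by rewrite inE => /eqP ->.
Qed.

(** The interior columns of a path between two columns of the same component are
    nonempty in [m], so a leading term of a path binomial divides [m]. *)
Lemma unsorted_path m : ~ sorted (missing m) m ->
  exists a b j s u u', [/\ (rank a < rank b)%N, (j < s)%N
    & (mvars (path_vars a b j s u u') <= m)%MM].
Proof.
move=> /unsorted_table[v [w [mv mw cvw ltc ltr]]].
have [u [u' mu]] := connector_supported (row v) (row w) cvw.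
exists (col v), (col w), (row v), (row w), u, u'; split=> //.
apply: mvars_le => [|x].
  by apply: path_vars_uniq; apply: contraTneq ltc => ->; rewrite ltnn.
by rewrite !inE !varK => /or3P[/eqP -> | /eqP -> | /mu].
Qed.

(** Among the sets [missing m], for the monomials [m] of [f], choose one that is
    maximal, say [sigma].  The monomials that [toric sigma] does not kill all have
    [sigma] as missing set, so they are sorted for [sigma] and have distinct
    images. *)
Lemma standard_eq0 f : (forall m, m \in msupp f -> sorted (missing m) m) ->
  (forall sigma, toric sigma f = 0) -> f = 0.
Proof.
move=> stdf tf; apply/eqP; apply: contraT; rewrite -msupp_eq0 => nz.
pose P (sigma : {set 'I_d3}) := has (fun m => missing m == sigma) (msupp f).
have [sigma0 P0] : exists sigma0, P sigma0.
  case E: (msupp f) nz => [//|m s] _; exists (missing m).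
  by apply/hasP; exists m; rewrite ?E ?mem_head.
have [sigma /hasP[m0 m0f /eqP e0] maxs] := arg_maxnP (fun x : {set _} => #|x|) P0.
have al0 : alive sigma m0 by rewrite alive_missing e0.
suff : toric sigma f != 0 by rewrite tf eqxx.
apply: (toric_neq0 m0f al0) => m mf; rewrite alive_missing => sub.
have em : sigma = missing m.
  apply/eqP; rewrite eqEcard sub; apply: maxs.
  by apply/hasP; exists m.
by apply: toric_exp_inj; [rewrite em | rewrite -e0]; apply: stdf.
Qed.

Lemma edge_ideal_reduction m : ~ sorted (missing m) m ->
  edge_ideal 'X_[m] \/
  exists2 m', (mweight wt m' < mweight wt m)%N & edge_ideal ('X_[m] - 'X_[m']).
Proof.
move=> /unsorted_path[a [b [j [s [u [u' [ab js le_m]]]]]]]; right.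
apply: (binomial_reduction edge_ideal_closed _ (path_vars_weight u u' ab js)) => //.
by apply: path_basis_sub; exists a, b, j, s, u, u'.
Qed.

Lemma edge_idealP f : edge_ideal f <-> forall sigma, toric sigma f = 0.
Proof.
split=> [Jf sigma | tf]; first exact: edge_ideal_sub_toric.
have [f' [Jf' stdf' _]] :=
  mpoly_normal_form edge_ideal_closed edge_ideal_reduction f.
suff f'0 : f' = 0 by move: Jf'; rewrite f'0 subr0.
apply: (standard_eq0 stdf') => sigma.
have := edge_ideal_sub_toric sigma Jf'.
by rewrite /toric_ideal /= toricB tf sub0r => /eqP; rewrite oppr_eq0 => /eqP.
Qed.

(** A sorted initial monomial of an element of the ideal would survive in its
    normal form, which is zero. *)
Lemma groebner_path_basis :
  groebner_basis (weight_le wt) edge_ideal path_basis.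
Proof.
apply: (@groebner_of_standard R n wt _ _ (fun m => sorted (missing m) m)).
- exact: finite_path_basis.
- exact: path_basis_sub.
- move=> m /unsorted_path[a [b [j [s [u [u' [ab js le_m]]]]]]].
  exists (path_binomial a b j s u u'), (mvars (path_vars a b j s u u')).
  split=> //; first by exists a, b, j, s, u, u'.
  by apply: initial_binomial; exact: path_vars_weight.
- move=> f m Jf inm stdm.
  have [f' [Jf' stdf' /(_ _ inm stdm)]] :=
    mpoly_normal_form edge_ideal_closed edge_ideal_reduction f.
  suff -> : f' = 0 by rewrite mcoeff_msupp mcoeff0 eqxx.
  apply: (standard_eq0 stdf'); apply/edge_idealP.
  have [_ JD JM] := edge_ideal_closed.
  have -> : f' = f + (-1) * (f - f') by ring.
  by apply: JD => //; apply: JM.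
Qed.

(** * Radicality and minimal primes *)

Lemma edge_ideal_radical : radical_ideal edge_ideal.
Proof.
move=> f i /edge_idealP Jf; apply/edge_idealP => sigma.
by have /eqP := Jf sigma; rewrite toric_expn expf_eq0 => /andP[_ /eqP].
Qed.

(** Otherwise choose, for each [sigma], an element of the kernel outside [Q]: the
    product of these elements lies in all kernels, hence in [Q]. *)
Lemma prime_over_edge_ideal Q : prime_ideal Q -> edge_ideal `<=` Q ->
  exists sigma, toric_ideal sigma `<=` Q.
Proof.
move=> [[_ Q1 Qlin] Qmul] JQ; apply: contrapT => none.
have /choice[h hP] : forall sigma, exists f, toric sigma f = 0 /\ ~ Q f.
  move=> sigma; apply: contrapT => nof; apply: none; exists sigma => f tf.
  by apply: contrapT => nQ; apply: nof; exists f.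
have : Q (\prod_sigma h sigma).
  apply: JQ; apply/edge_idealP => sigma.
  by rewrite (bigD1 sigma) //= toricM (proj1 (hP sigma)) mul0r.
apply: (big_ind (fun x => ~ Q x)) => [Q1' | f g nf ng Qfg | sigma _].
- by move/negP: Q1; apply; exact/mem_set.
- by have /orP[/set_mem | /set_mem] := Qmul f g (mem_set Qfg).
- by case: (hP sigma).
Qed.

(** For the complement of [k], the component [None] consists of the columns with
    index [k] only, so to delete [base k] as well does not split it and only adds
    generators.  Hence the full set gives no new minimal prime. *)
Lemma toric_ideal_full k : toric_ideal (~: [set k]) `<=` toric_ideal [set: 'I_d3].
Proof.
rewrite toric_idealE.
apply: ideal_gen_sub; first exact: toric_ideal_closed.
move=> f [[[i [j [t [i0 _ ->]]]] | [j [s [[a as_] [[b bs] ->]]]]] | ].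
- by rewrite /toric_ideal /= (toric_var _ (i, t) j) /dead /= i0 inE.
- rewrite [X in _ - X]mulrC; apply: (toric_minor (a := a) (b := b)).
  move: as_ bs; rewrite !inE !negbK => /eqP ea /eqP eb.
  by rewrite /component ea eb !inE eqxx !orbT.
- move=> [t _ [j [s [[i i0] [[r r0] ->]]]]].
  rewrite [X in _ - X]mulrC.
  by apply: (toric_minor (a := (i, t)) (b := (r, t))); rewrite /component eqxx !orbT.
Qed.

Lemma minimal_prime_toric P : (0 < d3)%N -> minimal_prime edge_ideal P ->
  exists2 sigma : {set 'I_d3}, (exists k, k \notin sigma) & P = toric_ideal sigma.
Proof.
move=> d3_gt0 [Pprime JP Pmin].
have [sigma sP] := prime_over_edge_ideal Pprime JP.
have [/existsP[k ks] | full] := boolP [exists k, k \notin sigma].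
  exists sigma; first by exists k.
  by apply/esym/Pmin => //; [exact: toric_ideal_prime | exact: edge_ideal_sub_toric].
pose k0 := Ordinal d3_gt0.
exists (~: [set k0]); first by exists k0; rewrite !inE eqxx.
apply/esym/Pmin; [exact: toric_ideal_prime | exact: edge_ideal_sub_toric |].
have sE : sigma = [set: 'I_d3]%SET.
  apply/finset.setP => k; rewrite inE; apply: contraNT full => ks.
  by apply/existsP; exists k.
by move=> f /toric_ideal_full; rewrite -sE; exact: sP.
Qed.

(** The unknowns p_+jk in the ideal of [tau] force [tau] into [sigma].  If [k] is
    in [sigma] but not in [tau], and [l] is in neither, then a minor of the
    columns (2,k), (2,l) is in the ideal of [tau], but these columns lie in
    different components for [sigma]. *)
Lemma toric_ideal_incomparable sigma tau : (1 < d1)%N -> (1 < d2)%N ->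
    (exists k, k \notin sigma) -> toric_ideal tau `<=` toric_ideal sigma ->
  tau = sigma.
Proof.
move=> d1_gt1 d2_gt1 [l ls] sub.
pose j0 : 'I_d2 := Ordinal (ltnW d2_gt1); pose j1 : 'I_d2 := Ordinal d2_gt1.
have Xneq0 (v : 'I_N) : 'X_v != 0 :> {mpoly R[N]}.
  by rewrite -msupp_eq0 msuppX.
have tau_sub : tau \subset sigma.
  apply/fintype.subsetP => k kt; apply: contraT => ks.
  have : toric_ideal sigma 'X_(var (base k) j0).
    by apply: sub; rewrite /toric_ideal /= toric_var /dead /= kt.
  rewrite /toric_ideal /= toric_var /dead /= (negPf ks) => /eqP.
  by rewrite mulf_eq0 !(negPf (Xneq0 _)).
apply/eqP; rewrite finset.eqEsubset tau_sub; apply/fintype.subsetP => k ks.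
apply: contraT => kt.
have lt : l \notin tau by apply: contra ls => /(fintype.subsetP tau_sub).
pose i1 : 'I_d1 := Ordinal d1_gt1.
have : toric_ideal sigma (minor (i1, k) (i1, l) j0 j1).
  apply: sub; apply: toric_minor.
  by rewrite /component /= (negPf kt) (negPf lt) eqxx ?orbT.
rewrite /toric_ideal /= /minor toricB !toricM !toric_var /dead /component /=.
rewrite ks (negPf ls).
(* The exponent of the unknown of component [Some k] and row [j0] differs. *)
rewrite -!mpolyXD => /eqP; rewrite subr_eq0 => /eqP.
move/(congr1 (fun f : {mpoly R[N]} => head 0%MM (msupp f))); rewrite !msuppX /=.
move/(congr1 (fun e : 'X_{1..N} => e (enum_rank (inl (Some k, j0) : T)))).
rewrite !mnmDE !mnm1E !(inj_eq enum_rank_inj).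
by rewrite !(inj_eq (@inl_inj _ _)) !xpair_eqE !eqxx andbF.
Qed.

Lemma minimal_prime_toricE : (1 < d1)%N -> (1 < d2)%N -> (0 < d3)%N ->
  [set P | minimal_prime edge_ideal P] =
  toric_ideal @`
    [set sigma | sigma \in [pred x : {set 'I_d3} | x != [set: 'I_d3]%SET]].
Proof.
move=> d1_gt1 d2_gt1 d3_gt0.
have properP (sigma : {set 'I_d3}) :
    sigma != [set: 'I_d3]%SET <-> exists k, k \notin sigma.
  rewrite -finset.subTset; split=> [/fintype.subsetPn[k _ ks] | [k ks]].
    by exists k.
  by apply/fintype.subsetPn; exists k.
apply/seteqP; split=> [P /= /(minimal_prime_toric d3_gt0)[sigma ks ->] | P].
  by exists sigma => //; apply/properP.
move=> [sigma /properP ks <-]; split.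
- exact: toric_ideal_prime.
- exact: edge_ideal_sub_toric.
move=> Q Qprime JQ Qs; have [tau tQ] := prime_over_edge_ideal Qprime JQ.
have e : tau = sigma.
  by apply: toric_ideal_incomparable => // f /tQ; exact: Qs.
by apply/seteqP; split=> //; rewrite -e.
Qed.

Lemma card_minimal_primes : (1 < d1)%N -> (1 < d2)%N -> (0 < d3)%N ->
  [set P | minimal_prime edge_ideal P] #= `I_(2 ^ d3 - 1).
Proof.
move=> d1_gt1 d2_gt1 d3_gt0; rewrite minimal_prime_toricE //.
set proper := [pred x : {set 'I_d3} | x != [set: 'I_d3]%SET].
have cardP : #|proper| = (2 ^ d3 - 1)%N.
  have -> : #|proper| = #|predC1 ([set: 'I_d3]%SET)| by apply: eq_card.
  by rewrite cardC1 -cardsT -powersetT card_powerset cardsT card_ord subn1.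
apply: (@card_eq_trans _ _ _ _ [set sigma | sigma \in proper]).
  apply: inj_card_eq => sigma tau /set_mem /= ps _ e.
  apply/esym; apply: toric_ideal_incomparable => //; last by rewrite e.
  move: ps; rewrite inE -finset.subTset => /fintype.subsetPn[k _ ks].
  by exists k.
rewrite -cardP; have -> : [set sigma | sigma \in proper] =
    (@enum_val _ proper) @` [set: 'I_#|proper|].
  apply/seteqP; split=> [sigma /= ps | _ [i _ <-]]; last exact: enum_valP.
  by exists (enum_rank_in ps sigma) => //; rewrite enum_rankK_in.
apply: (@card_eq_trans _ _ _ _ [set: 'I_#|proper|]).
  by apply: inj_card_eq => i k _ _; exact: enum_val_inj.
by rewrite card_eq_sym; exact: card_II.
Qed.

(** * Change of coordinates *)

Local Notation chg := (@change_coord R d1 d2 d3).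

Lemma change_coord_preim_closed : ideal_closed [set f | edge_ideal (chg f)].
Proof.
have [J0 JD JM] := edge_ideal_closed; rewrite /change_coord.
split=> /= [|f g Jf Jg|c f Jf].
- by rewrite comp_mpoly0.
- by rewrite comp_mpolyD; exact: JD.
- by rewrite rmorphM; exact: JM.
Qed.

Lemma change_coord_unk i j k : chg (unk R i j k) = old_unk R (i, j, k).
Proof.
by rewrite /change_coord /unk comp_mpolyXU -tnth_nth tnth_mktuple enum_rankK.
Qed.

Definition old_coef (i r : 'I_d1) : ring :=
  if (i == 0 :> nat)%N then (if (r == 0 :> nat)%N then 1 else -1)
  else (r == i)%:R.

Lemma old_unkE i j k :
  old_unk R (i, j, k) = \sum_r old_coef i r * unk R r j k.
Proof.
rewrite /old_unk /old_coef; case: ifP => i0; last first.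
  rewrite (bigD1 i) //= eqxx mul1r big1 ?addr0 // => r /negPf ->.
  by rewrite mul0r.
rewrite [RHS](bigD1 i) //= i0 mul1r -sumrN; congr (_ + _).
apply: eq_big => r; first by rewrite -val_eqE /= (eqP i0).
by move=> /negPf ->; rewrite mulN1r.
Qed.

(** The inverse change of coordinates: the p_ijk with i in {+,2,...,d1} in terms
    of the original unknowns. *)
Definition new_unk (i : 'I_d1) j k : ring :=
  if (i == 0 :> nat)%N then unk_sum R d1 j k else unk R i j k.

Definition new_coef (i r : 'I_d1) : ring :=
  if (i == 0 :> nat)%N then 1 else (r == i)%:R.

Lemma new_unkE i j k : new_unk i j k = \sum_r new_coef i r * unk R r j k.
Proof.
rewrite /new_unk /new_coef; case: ifP => i0.
  by apply: eq_bigr => r _; rewrite mul1r.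
by rewrite (bigD1 i) //= eqxx mul1r big1 ?addr0 // => r /negPf ->; rewrite mul0r.
Qed.

Lemma change_coord_new_unk i j k : chg (new_unk i j k) = unk R i j k.
Proof.
rewrite /new_unk; case: ifP => i0; last by rewrite change_coord_unk /old_unk i0.
rewrite /unk_sum (bigD1 i) //= /change_coord comp_mpolyD raddf_sum /=.
rewrite -?/(change_coord _) change_coord_unk /old_unk i0 -addrA -[RHS]addr0.
congr (_ + _).
apply/eqP; rewrite addrC subr_eq0; apply/eqP.
apply: eq_big => r; first by rewrite -val_eqE /= (eqP i0).
rewrite -val_eqE /= (eqP i0) => /negPf ri.
by rewrite -/(change_coord _) change_coord_unk /old_unk ri.
Qed.

Lemma change_coord_surj f : exists g, chg g = f.
Proof.
pose new v := new_unk (col v).1 (row v) (col v).2.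
exists (f \mPo [tuple new v | v < n]).
rewrite {2}[f]mpolyE comp_mpolyEX /change_coord raddf_sum /=.
apply: eq_bigr => m _; rewrite comp_mpolyZ; congr (_ *: _).
rewrite comp_mpolyX rmorph_prod /= [RHS]mpolyXE_id; apply: eq_bigr => v _.
rewrite rmorphXn /= tnth_mktuple -/(change_coord _) change_coord_new_unk.
congr (_ ^+ _); exact: (congr1 (fun x => 'X_x) (varK v)).
Qed.

(** Both coordinate changes replace each column by a combination of the columns
    with the same [k], with coefficients independent of the row.  As minors are
    bilinear in the columns, each set of generators is sent into the ideal
    generated by the other one. *)
Lemma model_ideal_plusE : model_ideal_plus R d1 d2 d3 = edge_ideal.
Proof.
apply/seteqP; split=> [_ [f If <-] | ].
  move: f If; apply: ideal_gen_sub; first exact: change_coord_preim_closed.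
  move=> f [[i [r [j [s [k ->]]]]] | [j [s [k [t ->]]]]] /=;
    rewrite /change_coord comp_mpolyB !rmorphM /= -?/(change_coord _).
    rewrite !change_coord_unk !old_unkE; apply: (minor_bilinear
      (x := fun x => unk R x j k) (y := fun x => unk R x s k)
      (z := fun x => unk R x j k) (t := fun x => unk R x s k)
      (old_coef i) (old_coef r) edge_ideal_closed) => x y.
    by apply: (@minor_edge_ideal (x, k) (y, k)); rewrite /linked eqxx.
  pose i0 := Ordinal d1_gt0.
  have chgS j' k' : chg (unk_sum R d1 j' k') = unk R i0 j' k'.
    exact: (change_coord_new_unk i0).
  rewrite !chgS [X in _ - X]mulrC.
  by apply: (@minor_edge_ideal (i0, k) (i0, t)); rewrite /linked /= orbT.
have [I0 ID IM] : ideal_closed (@model_ideal R d1 d2 d3).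
  exact: ideal_gen_closed.
apply: ideal_gen_sub.
  split; rewrite /model_ideal_plus.
  - by exists 0 => //; rewrite /change_coord comp_mpoly0.
  - move=> _ _ [f If <-] [g Ig <-]; exists (f + g); first exact: ID.
    by rewrite /change_coord comp_mpolyD.
  - move=> c _ [f If <-]; have [c' <-] := change_coord_surj c.
    by exists (c' * f); [exact: IM | rewrite /change_coord rmorphM].
move=> _ [[i k] [[r t] [j [s [lnk ->]]]]].
exists (new_unk i j k * new_unk r s t - new_unk i s k * new_unk r j t); last first.
  rewrite /change_coord comp_mpolyB !rmorphM /= -?/(change_coord _).
  by rewrite !change_coord_new_unk.
move: lnk => /orP[/= /eqP <- | /andP[/= i0 r0]].
  rewrite !new_unkE; apply: (minor_bilinear
      (x := fun x => unk R x j k) (y := fun x => unk R x s k)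
      (z := fun x => unk R x j k) (t := fun x => unk R x s k)
      (new_coef i) (new_coef r)) => [|x y]; first exact: ideal_gen_closed.
  by apply: mem_ideal_gen; left; exists x, y, j, s, k.
rewrite /new_unk i0 r0 [X in _ - X]mulrC; apply: mem_ideal_gen; right.
by exists j, s, k, t.
Qed.

End Model.

Theorem theorem1 (R : realType) (d1 d2 d3 : nat)
    (hd1 : (0 < d1)%N) (hd2 : (0 < d2)%N) (hd3 : (0 < d3)%N) :
  let IM := model_ideal_plus R d1 d2 d3 in
  [/\ (exists (le : rel 'X_{1..nunk d1 d2 d3})
              (G : set {mpoly R[nunk d1 d2 d3]}),
         [/\ monomial_order le,
             groebner_basis le IM G
           & forall g, G g -> squarefree_binomial g /\
               [\/ has_degree g 2, has_degree g 3 | has_degree g 4]]),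
      radical_ideal IM,
      ((1 < d1)%N -> (1 < d2)%N ->
         [set P | minimal_prime IM P] #= `I_(2 ^ d3 - 1))
    & forall P, minimal_prime IM P ->
        exists2 sigma : {set 'I_d3}, (exists k, k \notin sigma)
          & P = generic_minors_ideal R d1 d2 d3 sigma].
Proof.
rewrite /= (@model_ideal_plusE R d1 d2 d3 hd1); split.
- exists (weight_le (@wt d1 d2 d3)), (@path_basis R d1 d2 d3 hd1); split.
  + exact: monomial_order_weight_le.
  + exact: groebner_path_basis.
  + by move=> g; exact: path_basis_shape.
- exact: (edge_ideal_radical hd1).
- by move=> d1_gt1 d2_gt1; exact: card_minimal_primes.
- move=> P /(minimal_prime_toric hd1 hd3)[sigma ks ->].
  by exists sigma => //; exact: toric_idealE.
Qed.
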